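(* Let $\varepsilon,\delta\in(0,1)$, let $\mu>0$, and let $X_1,\dots,X_N$ be i.i.d. Rayleigh random variables with second moment $\mu$. Put $\widehat{\mu}_N=\frac{1}{N}\sum_{i=1}^N X_i^2$. If $$N>\frac{2(3+2\varepsilon)\ln\frac{2}{\delta}}{3\varepsilon^2},$$ then $$\Pr\left\{\left|\frac{\widehat{\mu}_N-\mu}{\mu}\right|<\varepsilon\right\}>1-\delta .$$
   Context: A Rayleigh random variable with second moment $\mu>0$ is a real random variable with density $f(x)=\frac{2x}{\mu}e^{-x^2/\mu}$ for $x\ge 0$ and $f(x)=0$ for $x<0$. The sample size $N$ is a positive integer. *)

(* Defs.v *)
From HB Require Import structures.
From mathcomp Require Import all_boot all_order all_algebra.
From mathcomp Require Import all_classical all_reals all_analysis.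

Set Implicit Arguments.
Unset Strict Implicit.
Unset Printing Implicit Defensive.

Import Order.TTheory GRing.Theory Num.Theory.
Import numFieldNormedType.Exports.

Local Open Scope classical_set_scope.
Local Open Scope ring_scope.

Definition rayleigh_pdf (R : realType) (mu : R) (x : R) : R :=
  if 0 <= x then 2 * x / mu * expR (- (x ^+ 2 / mu)) else 0.

Definition is_rayleigh d (T : measurableType d) (R : realType)
    (P : probability T R) (mu : R) (X : {RV P >-> R}) : Prop :=
  forall A : set R, measurable A ->
    distribution P X A
    = (\int[lebesgue_measure]_(x in A) (rayleigh_pdf mu x)%:E)%E.

(* The product rule is required for every subfamily J, not only for pairs. *)
Definition mutually_independent d d' (T : measurableType d)
    (T' : measurableType d') (R : realType) (P : probability T R)
    (I : finType) (X : I -> {RV P >-> T'}) : Prop :=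
  forall (J : {set I}) (A : I -> set T'),
    (forall i, measurable (A i)) ->
    P (\bigcap_(i in [set` J]) (X i @^-1` A i))
    = (\prod_(i in J) P (X i @^-1` A i))%E.

Definition sample_second_moment d (T : measurableType d) (R : realType)
    (P : probability T R) (N : nat) (X : 'I_N -> {RV P >-> R}) (w : T) : R :=
  N%:R^-1 * \sum_(i < N) X i w ^+ 2.

(* Main.v *)
(* Chernoff bound.  If X is Rayleigh with second moment mu, then X^2/mu is
   exponential of rate 1, so E exp(t X^2/mu) = 1/(1-t) for t < 1; for
   t = s/(1+s) this bounds the probability that the mean of the X_i^2/mu lies
   beyond 1+s, on the side of the sign of s > -1, by ((1+s) e^{-s})^N.
   Since ln(1+s) <= s - 3s^2/(2(3+2s)), both tails s = eps and s = -eps have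
   probability less than delta/2 for the prescribed N. *)
Require Import Defs.
From mathcomp Require Import all_boot all_order all_algebra.
From mathcomp Require Import all_classical all_reals all_analysis.
From mathcomp Require Import measurable_realfun ring lra.

Set Implicit Arguments.
Unset Strict Implicit.
Unset Printing Implicit Defensive.

Import Order.TTheory GRing.Theory Num.Theory.
Import numFieldNormedType.Exports.

Local Open Scope classical_set_scope.
Local Open Scope ring_scope.

(** * Weighted integrals determined by their values on indicators *)

Section weighted_integral.
Local Open Scope ereal_scope.
Import HBNNSimple.

(** Monotone convergence along the simple approximations of [f]. On the right, [m], [h] and [phi]
    occur only through weighted integrals of indicators, which is what allows two such triples to be
    compared. *)
Lemma weighted_integral_approx d d' (T : measurableType d)
    (T' : measurableType d') (R : realType) (m : {measure set T -> \bar R})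
    (phi : T -> T') (h : T -> R) (f : T' -> R)
    (mf : measurable_fun setT (EFin \o f : T' -> \bar R)) :
  measurable_fun setT phi -> measurable_fun setT h ->
  (forall x, (0 <= h x)%R) -> (forall y, (0 <= f y)%R) ->
  \int[m]_x (h x * f (phi x))%:E =
  limn (fun n => \sum_(r \in range (nnsfun_approx measurableT mf n))
    (r%:E * \int[m]_x (h x *
      \1_(nnsfun_approx measurableT mf n @^-1` [set r]) (phi x))%:E)).
Proof.
move=> mphi mh h0 f0; set f_ := nnsfun_approx measurableT mf.
have mhf (g : T' -> R) : measurable_fun setT g ->
    measurable_fun setT (fun x => (h x * g (phi x))%:E).
  move=> mg; apply/measurable_EFinP; apply: measurable_funM => //.
  exact: measurableT_comp.
transitivity (limn (fun n => \int[m]_x (h x * f_ n (phi x))%:E)).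
  rewrite -monotone_convergence//; first last.
  - move=> x _ a b ab; rewrite lee_fin ler_wpM2l//.
    exact/lefP/nd_nnsfun_approx.
  - by move=> n x _; rewrite lee_fin mulr_ge0.
  - by move=> n; exact: mhf.
  apply: eq_integral => x _; apply/esym/cvg_lim => //.
  under eq_fun do rewrite EFinM.
  rewrite EFinM; apply: cvgeZl => //.
  by apply: (cvg_nnsfun_approx measurableT mf) => // y _; rewrite lee_fin.
congr (limn _); apply/funext => n.
(* Here [r] is any real, possibly negative; the term is nonzero only if [r] is a value of [f_ n],
   hence nonnegative. *)
have term_ge0 r x : 0 <= (r * (h x * \1_(f_ n @^-1` [set r]) (phi x)))%:E.
  rewrite lee_fin indicE; have [/set_mem /= <-|_] := boolP (phi x \in _).
    by rewrite !mulr_ge0.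
  by rewrite /= !mulr0.
transitivity (\int[m]_x (\sum_(r \in range (f_ n))
    (r * (h x * \1_(f_ n @^-1` [set r]) (phi x)))%:E)).
  apply: eq_integral => x _; rewrite fsumEFin//; congr EFin.
  rewrite [in LHS]fimfunE [LHS](@mulr_fsumr _ _ _ _ _)//.
  by apply: eq_fsbigr => r _; rewrite mulrCA.
rewrite ge0_integral_fsum//; last first.
  move=> r; apply/measurable_EFinP/measurable_funM => //.
  exact/measurable_EFinP/mhf.
apply: eq_fsbigr => r /set_mem[y _ <-].
under eq_integral do rewrite EFinM.
rewrite ge0_integralZl//; first exact: mhf.
- by move=> x _; rewrite lee_fin mulr_ge0.
- by rewrite lee_fin.
Qed.

(** The hypothesis on indicators says that the images of [h1 m1] under [phi1] and of [h2 m2] under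
    [phi2] are the same measure. It serves both to factor expectations and to pass from [P] to a
    density. *)
Lemma eq_weighted_integral d1 d2 d' (T1 : measurableType d1)
    (T2 : measurableType d2) (T' : measurableType d') (R : realType)
    (m1 : {measure set T1 -> \bar R}) (m2 : {measure set T2 -> \bar R})
    (phi1 : T1 -> T') (phi2 : T2 -> T') (h1 : T1 -> R) (h2 : T2 -> R) :
  measurable_fun setT phi1 -> measurable_fun setT phi2 ->
  measurable_fun setT h1 -> measurable_fun setT h2 ->
  (forall x, (0 <= h1 x)%R) -> (forall x, (0 <= h2 x)%R) ->
  (forall A, measurable A -> \int[m1]_x (h1 x * \1_A (phi1 x))%:E =
                             \int[m2]_x (h2 x * \1_A (phi2 x))%:E) ->
  forall f : T' -> R, measurable_fun setT f -> (forall y, (0 <= f y)%R) ->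
  \int[m1]_x (h1 x * f (phi1 x))%:E = \int[m2]_x (h2 x * f (phi2 x))%:E.
Proof.
move=> mp1 mp2 mh1 mh2 h10 h20 h12 f /measurable_EFinP mf f0.
rewrite !(weighted_integral_approx _ mf)//; congr (limn _); apply/funext => n.
by apply: eq_fsbigr => r _; rewrite h12.
Qed.

End weighted_integral.

(** * Expectations of products of independent variables *)

Lemma integral_indicRV d d' (T : measurableType d) (T' : measurableType d')
    (R : realType) (P : probability T R) (X : {RV P >-> T'}) (A : set T') :
  measurable A -> (\int[P]_w (\1_A (X w))%:E = P (X @^-1` A))%E.
Proof.
move=> mA; rewrite -[X in P X]setIT -integral_indic//.
exact: measurable_funPTI.
Qed.

(* The product rule for events is the case of indicators; the factors are then
   replaced by arbitrary functions one index at a time. *)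
Lemma expectation_prod_indep d d' (T : measurableType d)
    (T' : measurableType d') (R : realType) (P : probability T R)
    (I : finType) (X : I -> {RV P >-> T'}) (f : I -> T' -> R) :
  mutually_independent X ->
  (forall i, measurable_fun setT (f i)) -> (forall i y, 0 <= f i y) ->
  (forall i, \int[P]_w (f i (X i w))%:E < +oo)%E ->
  (\int[P]_w (\prod_i f i (X i w))%:E = \prod_i \int[P]_w (f i (X i w))%:E)%E.
Proof.
move=> indep.
have indicator_case (A : I -> set T') : (forall i, measurable (A i)) ->
    (\int[P]_w (\prod_i \1_(A i) (X i w))%:E =
     \prod_i \int[P]_w (\1_(A i) (X i w))%:E)%E.
  move=> mA.
  have mXA i : measurable (X i @^-1` A i) by exact: measurable_funPTI.
  have -> : (\prod_i \int[P]_w (\1_(A i) (X i w))%:E =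
      \prod_(i in [set: I]%SET) P (X i @^-1` A i))%E.
    apply: eq_big => [i|i _]; first by rewrite finset.in_setT.
    by rewrite integral_indicRV.
  rewrite -indep//.
  have mcap : measurable (\bigcap_(i in [set` [set: I]%SET]) (X i @^-1` A i)).
    exact: fin_bigcap_measurable.
  rewrite -[X in P X]setIT -integral_indic//.
  apply: eq_integral => w _; congr EFin; rewrite indicE.
  have [/set_mem wA|/negP wA] := boolP (w \in _).
    rewrite big1// => i _; rewrite indicE mem_set//.
    by apply: wA => /=; rewrite finset.in_setT.
  have [i iA] : exists i, ~ (A i (X i w)).
    apply/existsNP => h; apply: wA; rewrite inE => i _; exact: h.
  by rewrite (bigD1 i)//= indicE memNset ?mul0r.
(* Induction on the list [s] of indices whose functions may be arbitrary; all other functions are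
   indicators. The list [enum I] leaves no restriction. *)
suff gen (s : seq I) : forall f : I -> T' -> R,
    (forall i, i \notin s -> exists2 A, measurable A & f i = \1_A) ->
    (forall i, measurable_fun setT (f i)) -> (forall i y, 0 <= f i y) ->
    (forall i, \int[P]_w (f i (X i w))%:E < +oo)%E ->
    (\int[P]_w (\prod_i f i (X i w))%:E =
     \prod_i \int[P]_w (f i (X i w))%:E)%E.
  by apply: (gen (enum I)) => i; rewrite mem_enum.
elim: s => [|k s IH] {}f fA mf f0 foo.
  have /choice[A HA] : forall i, exists A, measurable A /\ f i = \1_A.
    by move=> i; have [A mA fiA] := fA i isT; exists A.
  have -> : f = fun i => \1_(A i) by apply/funext => i; have [] := HA i.
  by apply: indicator_case => i; have [] := HA i.
have Efin i : (\int[P]_w (f i (X i w))%:E)%E \is a fin_num.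
  by rewrite ge0_fin_numE// integral_ge0// => w _; rewrite lee_fin.
pose c := \prod_(i | i != k) fine (\int[P]_w (f i (X i w))%:E)%E.
have c0 : 0 <= c.
  by apply: prodr_ge0 => i _; rewrite fine_ge0// integral_ge0// => w _;
    rewrite lee_fin.
have cE : (\prod_(i | i != k) \int[P]_w (f i (X i w))%:E = c%:E)%E.
  by rewrite -prodEFin; apply: eq_bigr => i _; rewrite fineK.
have mfX i : measurable_fun setT (fun w => f i (X i w)).
  exact: measurableT_comp.
have h0 w : 0 <= \prod_(i | i != k) f i (X i w) by apply: prodr_ge0.
rewrite [RHS](bigD1 k)//= cE muleC -ge0_integralZl//; first last.
- by move=> w _; rewrite lee_fin.
- exact/measurable_EFinP.
under [LHS]eq_integral => w _ do rewrite (bigD1 k)//= mulrC.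
under [RHS]eq_integral do rewrite -EFinM.
(* Both sides integrate [f k] of [X k], once with the product of the other factors as weight and
   once with the constant [c]. It is enough to compare them with an indicator in place of [f k]. *)
apply: (eq_weighted_integral (h1 := fun w => \prod_(i | i != k) f i (X i w))
  (h2 := cst c)) => //.
  under eq_fun do rewrite -big_filter.
  exact: measurable_prod.
(* The family [g] has an indicator at [k] too, so the induction hypothesis for the shorter list
   applies. *)
move=> A mA; pose g i := if i == k then \1_A else f i.
have gk w : \1_A (X k w) = g k (X k w) by rewrite /g eqxx.
have gne i w : i != k -> f i (X i w) = g i (X i w).
  by rewrite /g => /negbTE ->.
have := IH g.
rewrite (_ : \prod_i _ = c%:E * \int[P]_w (\1_A (X k w))%:E)%E; last first.
  rewrite (bigD1 k)//= muleC -cE; congr (_ * _)%E.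
    by apply: eq_bigr => i ik; apply: eq_integral => w _; rewrite -gne.
  by apply: eq_integral => w _; rewrite -gk.
rewrite -ge0_integralZl//; last first.
  apply/measurable_EFinP; exact: measurableT_comp.
under eq_integral do rewrite -EFinM.
move=> <-.
- apply: eq_integral => w _; congr EFin; rewrite [RHS](bigD1 k)//= -gk mulrC.
  by congr (_ * _); apply: eq_bigr => i /gne.
- move=> i; rewrite /g; case: eqVneq => [_ _|ik si]; first by exists A.
  by apply: fA; rewrite inE negb_or ik.
- by move=> i; rewrite /g; case: ifP.
- by move=> i y; rewrite /g; case: ifP.
- move=> i; rewrite /g; case: ifP => // _.
  by rewrite integral_indicRV// (le_lt_trans (probability_le1 _ _)) ?ltry//;
    exact: measurable_funPTI.
Qed.

(** * The Rayleigh density and exponential moments of the square *)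

Lemma rayleigh_pdf_ge0 (R : realType) (mu x : R) :
  0 < mu -> 0 <= rayleigh_pdf mu x.
Proof.
move=> mu0; rewrite /rayleigh_pdf; case: ifP => // x0.
by rewrite !mulr_ge0 ?expR_ge0 ?invr_ge0// ltW.
Qed.

Lemma integral_rayleigh_pdf (R : realType) (mu : R) : 0 < mu ->
  (\int[lebesgue_measure]_x (rayleigh_pdf mu x)%:E = 1)%E.
Proof.
move=> mu0.
(* Without the cutoff at 0, [g] is differentiable on the whole line and has the antiderivative [F],
   which goes from -1 at 0 to 0 at infinity. *)
pose g x : R := 2 * x / mu * expR (- (x ^+ 2 / mu)).
pose F x : R := - expR (- (x ^+ 2 / mu)).
have dF (x : R) : is_derive x 1 F (g x).
  rewrite /F /g; apply: is_derive_eq.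
  rewrite /GRing.scale/=; ring.
have cg : continuous g.
  move=> x; apply: differentiable_continuous.
  apply/derivable1_diffP; exact: ex_derive.
have cF : continuous F.
  move=> x; apply: differentiable_continuous.
  apply/derivable1_diffP; exact: ex_derive.
have -> : (\int[lebesgue_measure]_x (rayleigh_pdf mu x)%:E =
    \int[lebesgue_measure]_(x in `[0%R, +oo[) (g x)%:E)%E.
  rewrite [RHS]integral_mkcond; apply: eq_integral => x _.
  rewrite patchE/= mem_setE in_itv/= andbT /rayleigh_pdf.
  by case: ifP.
rewrite (@ge0_continuous_FTC2y _ g F 0 0)//.
- by rewrite /F expr0n/= mul0r oppr0 expR0 -EFinB sub0r opprK.
- by move=> x x0; rewrite /g !mulr_ge0 ?expR_ge0 ?invr_ge0// ltW.
- exact: continuous_subspaceT.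
- rewrite -oppr0; apply: cvgN.
  apply: (@cvg_comp _ _ _ (fun x => x ^+ 2 / mu) (fun z => expR (- z))
    _ (pinfty_nbhs R)); last exact: cvgr_expR.
  apply: gt0_cvgMly; first by rewrite invr_gt0.
  exact: cvgr_expr2.
- exact/cvg_at_right_filter/cF.
- by move=> x _; rewrite derive1E derive_val.
Qed.

Lemma measurable_rayleigh_pdf (R : realType) (mu : R) :
  measurable_fun setT (rayleigh_pdf mu).
Proof.
apply: measurable_fun_ifT => //.
  by apply: measurable_fun_ler.
apply: measurable_funM; first by do 2 apply: measurable_funM => //.
apply: measurableT_comp => //.
apply: measurableT_comp => //.
apply: measurable_funM => //.
Qed.

(** [is_rayleigh] is this formula for indicators; it extends by comparing weight 1 with map [X]
    under [P] to the density with the identity map under Lebesgue measure. *)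
Lemma rayleigh_expectation d (T : measurableType d) (R : realType)
    (P : probability T R) (mu : R) (X : {RV P >-> R}) (f : R -> R) :
  0 < mu -> is_rayleigh mu X ->
  measurable_fun setT f -> (forall x, 0 <= f x) ->
  (\int[P]_w (f (X w))%:E =
   \int[lebesgue_measure]_x (rayleigh_pdf mu x * f x)%:E)%E.
Proof.
move=> mu0 Xmu mf f0.
have pdf0 x := rayleigh_pdf_ge0 x mu0.
have mpdf := measurable_rayleigh_pdf mu.
transitivity (\int[P]_w (1 * f (X w))%:E)%E.
  by apply: eq_integral => w _; rewrite mul1r.
apply: (eq_weighted_integral (h1 := cst 1) (phi2 := id)) => //.
  exact: (@measurable_funPT _ _ _ _ X).
move=> A mA.
transitivity (\int[P]_w (\1_A (X w))%:E)%E.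
  by apply: eq_integral => w _; rewrite mul1r.
rewrite integral_indicRV// -[LHS]/(distribution P X A) Xmu//.
apply: etrans; first exact: integral_mkcond.
apply: eq_integral => x _.
by rewrite patchE indicE; case: ifP => _; rewrite ?mulr1 ?mulr0.
Qed.

(** Tilting the density by exp(t x^2/mu) gives 1/(1-t) times the Rayleigh density with second moment
    mu/(1-t), whose total mass is 1. *)
Lemma rayleigh_sqr_mgf d (T : measurableType d) (R : realType)
    (P : probability T R) (mu : R) (X : {RV P >-> R}) (t : R) :
  0 < mu -> t < 1 -> is_rayleigh mu X ->
  (\int[P]_w (expR (t * (X w ^+ 2 / mu)))%:E = ((1 - t)^-1)%:E)%E.
Proof.
move=> mu0 t1 Xmu.
have t10 : 0 < 1 - t by rewrite subr_gt0.
rewrite (rayleigh_expectation (mu := mu)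
  (f := fun x => expR (t * (x ^+ 2 / mu))))//; last first.
  apply: measurableT_comp => //.
  apply: measurable_funM => //.
  apply: measurable_funM => //.
transitivity (\int[lebesgue_measure]_x
    ((1 - t)^-1%:E * (rayleigh_pdf (mu / (1 - t)) x)%:E))%E.
  apply: eq_integral => x _; rewrite -EFinM; congr EFin.
  rewrite /rayleigh_pdf; case: ifP => _; last by rewrite mul0r mulr0.
  rewrite -mulrA -expRD.
  have -> : - (x ^+ 2 / mu) + t * (x ^+ 2 / mu) = - (x ^+ 2 / (mu / (1 - t))).
    by field; rewrite !gt_eqF.
  by field; rewrite !gt_eqF.
rewrite ge0_integralZl//.
- by rewrite integral_rayleigh_pdf ?mule1// divr_gt0.
- by apply/measurable_EFinP; exact: measurable_rayleigh_pdf.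
- by move=> x _; rewrite lee_fin rayleigh_pdf_ge0// divr_gt0.
- by rewrite lee_fin invr_ge0 ltW.
Qed.

(** * A rational upper bound for the logarithm *)

Lemma ln1D_le (R : realType) (s : R) : -1 < s ->
  ln (1 + s) <= s - 3 * s ^+ 2 / (2 * (3 + 2 * s)).
Proof.
move=> s_gtN1.
(* [g] is the right side minus the left. It vanishes at 0 and its derivative [dg] has the sign of
   [x], so 0 is its minimum. *)
pose g x : R := x - 3 * x ^+ 2 / (2 * (3 + 2 * x)) - ln (1 + x).
pose dg x : R := x ^+ 3 / ((1 + x) * (3 + 2 * x) ^+ 2).
have dgP (x : R) : -1 < x -> is_derive x 1 g (dg x).
  move=> x_gtN1.
  have x1 : 0 < 1 + x by lra.
  have x3 : 3 + 2 * x != 0 by rewrite gt_eqF//; lra.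
  have := is_derive1_ln x1 => dln.
  have x6 : 2 * (3 + 2 * x) != 0 by rewrite mulf_neq0.
  rewrite /g; apply: is_derive_eq.
  rewrite /GRing.scale/= /dg; field.
  by rewrite x3 gt_eqF.
have g0 : g 0 = 0 by rewrite /g addr0 ln1 expr0n/= mulr0 mul0r !subr0.
suff : 0 <= g s by rewrite /g; lra.
rewrite -g0.
have MVT_g (a b : R) : -1 < a -> a <= b ->
    exists2 c, c \in `[a, b] & g b - g a = dg c * (b - a).
  move=> a_gtN1 ab; apply: (MVT_segment ab) => [x /[!in_itv]/= /andP[ax _]|].
    by apply: dgP; lra.
  apply: derivable_within_continuous => x /[!in_itv]/= /andP[ax _].
  have x_gtN1 : -1 < x by lra.
  by case: (dgP x x_gtN1).
have sgn_dg (x : R) : -1 < x -> (0 <= x -> 0 <= dg x) /\ (x <= 0 -> dg x <= 0).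
  move=> x_gtN1.
  have x0 : 0 <= ((1 + x) * (3 + 2 * x) ^+ 2)^-1.
    by rewrite invr_ge0 mulr_ge0 ?sqr_ge0//; lra.
  split=> hx; first by rewrite /dg mulr_ge0// exprn_ge0.
  rewrite /dg mulr_le0_ge0// exprSr mulr_ge0_le0// sqr_ge0//.
(* The mean value theorem between 0 and [s]: the intermediate point lies on the same side of 0 as
   [s], which fixes the sign of [dg] there. *)
have [s0|s0] := leP 0 s.
  have [|c] := MVT_g 0 s _ s0; first by rewrite ltrN10.
  rewrite in_itv/= => /andP[c0 cs] E.
  rewrite -subr_ge0 E mulr_ge0// ?subr_ge0//; apply sgn_dg => //; lra.
have [|c] := MVT_g s 0 s_gtN1; first exact: ltW.
rewrite in_itv/= => /andP[c0 cs] E.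
rewrite -subr_le0 E mulr_le0_ge0//; last lra.
by apply sgn_dg => //; lra.
Qed.

(** * The Chernoff bound for one tail *)

Lemma rayleigh_tail d (T : measurableType d) (R : realType)
    (P : probability T R) (N : nat) (mu s : R) (X : 'I_N -> {RV P >-> R}) :
  (0 < N)%N -> 0 < mu -> -1 < s ->
  mutually_independent X -> (forall i, is_rayleigh mu (X i)) ->
  (P [set w | (0 <= s * ((sample_second_moment X w - mu) / mu - s))%R]
   <= (((1 + s) * expR (- s)) ^+ N)%:E)%E.
Proof.
move=> N0 mu0 s_gtN1 indep Xmu.
have s1 : 0 < 1 + s by lra.
(* The choice t = s/(1+s) minimises exp(-t(1+s))/(1-t); it gives t(1+s) = s and 1/(1-t) = 1+s. *)
pose f x := expR (s / (1 + s) * (x ^+ 2 / mu)) * expR (- s).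
have mf : measurable_fun setT f.
  apply: measurable_funM => //; apply: measurableT_comp => //.
  by apply: measurable_funM => //; apply: measurable_funM.
have f0 x : 0 <= f x by rewrite mulr_ge0 ?expR_ge0.
have fE i : (\int[P]_w (f (X i w))%:E = ((1 + s) * expR (- s))%:E)%E.
  under eq_integral do rewrite EFinM muleC.
  rewrite ge0_integralZl//.
  - rewrite (@rayleigh_sqr_mgf _ _ _ _ mu)//; last first.
      by rewrite ltr_pdivrMr// mul1r; lra.
    rewrite -EFinM; congr EFin; rewrite mulrC; congr (_ * _).
    by field; rewrite gt_eqF//=; lra.
  - apply/measurable_EFinP; apply: measurableT_comp => //.
    apply: measurable_funM => //; apply: measurable_funM => //.
    by apply: measurable_funX.
set A := [set w | _].
(* As N/(1+s) is positive, the tail event is exactly the set where this product is at least 1. *)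
have prodE w : \prod_i f (X i w) =
    expR (N%:R / (1 + s) * (s * ((sample_second_moment X w - mu) / mu - s))).
  transitivity (expR (\sum_i (s / (1 + s) * (X i w ^+ 2 / mu) - s))).
    by rewrite expR_sum; apply: eq_bigr => i _; rewrite expRD.
  congr expR; rewrite sumrB -mulr_sumr -mulr_suml sumr_const card_ord.
  rewrite /sample_second_moment -mulr_natl.
  by field; rewrite !gt_eqF ?ltr0n.
have mprod : measurable_fun setT (fun w => \prod_i f (X i w)).
  apply: measurable_prod => i _; exact: measurableT_comp.
have k0 : 0 < N%:R / (1 + s) by rewrite divr_gt0// ltr0n.
have mA : measurable A.
  have -> : A = (fun w => \prod_i f (X i w)) @^-1` `[1, +oo[.
    by apply/seteqP; split=> w; rewrite /A/= in_itv/= andbT prodE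
      -[X in X <= expR _]expR0 ler_expR (pmulr_rge0 _ k0).
  rewrite -[_ @^-1` _]setTI; exact: mprod.
rewrite -[X in P X]setIT -integral_indic//.
have -> : (((1 + s) * expR (- s)) ^+ N)%:E =
    (\int[P]_w (\prod_i f (X i w))%:E)%E.
  rewrite (expectation_prod_indep (f := fun=> f) indep)//;
    last by move=> i; rewrite fE ltry.
  rewrite (eq_bigr _ (fun i _ => fE i)) prodEFin prodr_const card_ord//.
(* Markov's inequality: the indicator of [A] is at most the product, which is at least 1 on [A] and
   nonnegative elsewhere. *)
apply: ge0_le_integral => //.
- exact/measurable_EFinP/measurable_indic.
- exact/measurable_EFinP.
- move=> w _; rewrite lee_fin indicE.
  have [/set_mem wA|_] := boolP (w \in A); last by rewrite prodr_ge0.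
  by rewrite prodE -[leLHS]expR0 ler_expR (pmulr_rge0 _ k0).
Qed.

(** * Union bound over the two tails *)

Theorem theorem1 (d : measure_display) (T : measurableType d) (R : realType)
    (P : probability T R) (N : nat) (eps delta mu : R)
    (X : 'I_N -> {RV P >-> R})
    (N_gt0 : (0 < N)%N)
    (eps_gt0 : 0 < eps) (eps_lt1 : eps < 1)
    (delta_gt0 : 0 < delta) (delta_lt1 : delta < 1)
    (mu_gt0 : 0 < mu)
    (X_indep : mutually_independent X)
    (X_rayleigh : forall i, is_rayleigh mu (X i))
    (N_large :
      2 * (3 + 2 * eps) * ln (2 / delta) / (3 * eps ^+ 2) < N%:R) :
  ((1 - delta)%R%:E
   < P [set w | (`|(sample_second_moment X w - mu) / mu| < eps)%R])%E.
Proof.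
pose Z w := (sample_second_moment X w - mu) / mu.
have mZ : measurable_fun setT Z.
  apply: measurable_funM => //; apply: measurable_funB => //.
  apply: measurable_funM => //; apply: measurable_sum => i.
  exact: measurable_funX.
(* The factor [s] sets the direction: [tail eps] is Z >= eps and [tail (- eps)] is Z <= -eps. *)
pose tail (s : R) := [set w | 0 <= s * (Z w - s)].
have mtail s : measurable (tail s).
  have -> : tail s = (fun w => s * (Z w - s)) @^-1` `[0, +oo[.
    by apply/seteqP; split=> w; rewrite /tail/= in_itv/= andbT.
  rewrite -[_ @^-1` _]setTI.
  have : measurable_fun setT (fun w => s * (Z w - s)).
    by apply: measurable_funM => //; apply: measurable_funB.
  exact.
have tail_lt (s : R) : `|s| = eps -> (P (tail s) < (delta / 2)%:E)%E.
  move=> s_eps.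
  have /andP[s_ge s_le] : - eps <= s <= eps by rewrite -ler_norml s_eps.
  have s2 : s ^+ 2 = eps ^+ 2 by rewrite -s_eps real_normK ?num_real.
  have e2 : 0 < eps ^+ 2 by rewrite exprn_gt0.
  have s1 : 0 < 1 + s by lra.
  apply: le_lt_trans.
    by apply: rayleigh_tail => //; lra.
  (* Taking logarithms, the goal becomes N (ln(1+s) - s) < -ln(2/delta). *)
  rewrite lte_fin -[1 + s]lnK ?posrE// -expRD -expRM_natl.
  rewrite -[ltRHS]lnK ?posrE ?divr_gt0// ltr_expR.
  rewrite -invf_div lnV ?posrE ?divr_gt0//.
  set L := ln (2 / delta) in N_large *.
  (* The decay rate of the upper tail; [N_large] says that N r exceeds ln(2/delta). *)
  pose r := 3 * eps ^+ 2 / (2 * (3 + 2 * eps)).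
  have r0 : 0 < r by rewrite divr_gt0// mulr_gt0//; lra.
  have LN : L < N%:R * r.
    rewrite -ltr_pdivrMr//; apply: le_lt_trans N_large.
    rewrite le_eqVlt; apply/orP; left; apply/eqP; rewrite /r; field.
    by rewrite !gt_eqF//; lra.
  (* Since s <= eps, the denominator is largest at s = eps, so the rate of the upper tail also
     serves for the lower one. *)
  have rs : r <= 3 * s ^+ 2 / (2 * (3 + 2 * s)).
    rewrite s2 /r; apply: ler_wpM2l; first by rewrite mulr_ge0 ?sqr_ge0.
    by rewrite lef_pV2 ?posrE; lra.
  have lns : ln (1 + s) - s <= - r.
    by rewrite lerBlDr; apply: le_trans (ln1D_le _) _; lra.
  apply: (@le_lt_trans _ _ (N%:R * - r)); first by rewrite ler_wpM2l.
  by rewrite mulrN ltrN2.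
set G := [set w | _].
have GE : G = ~` (tail eps `|` tail (- eps)).
  rewrite /G /tail; apply/seteqP; split => w /=; rewrite -/(Z w).
    rewrite ltr_norml => /andP[h1 h2]; apply/not_orP; split; apply/negP.
      by rewrite -ltNge pmulr_rlt0//; lra.
    by rewrite mulNr -mulrN -ltNge pmulr_rlt0//; lra.
  move=> /not_orP[/negP]; rewrite -ltNge pmulr_rlt0// => h1 /negP.
  rewrite mulNr -mulrN -ltNge pmulr_rlt0// => h2.
  by rewrite ltr_norml; apply/andP; split; lra.
have mU : measurable (tail eps `|` tail (- eps)) by exact: measurableU.
have PU : (P (tail eps `|` tail (- eps)%R) < delta%:E)%E.
  apply: le_lt_trans (measureU2 _ _ _) _ => //.
  by rewrite [delta]splitr EFinD lteD// tail_lt ?normrN ?gtr0_norm.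
rewrite GE probability_setC//; move: PU.
rewrite -(fineK (fin_num_measure P _ mU)) -EFinB !lte_fin; lra.
Qed.
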